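(* Let $K=\{x\in B_4:\rho_4(x)=I\}$ be the kernel of the reduced Burau representation $\rho_4:B_4\to GL\left(3,\mathbb{Z}[t,t^{-1}]\right)$. Then $K$ is contained in the subgroup $G=\langle\tau,\Delta\rangle$ of $B_4$ generated by $\tau=\sigma_1\sigma_2\sigma_3$ and $\Delta=\sigma_1\sigma_2\sigma_3\sigma_1\sigma_2\sigma_1$. Moreover, if $K$ is non-trivial, then there exists a non-identity element $\omega\in K$ that can be written in the form $$\omega=\theta^m\,\tau^2\,\Delta\,\tau^{i_1}\,\Delta\,\tau^{i_2}\,\Delta\cdots\Delta\,\tau^{i_k}\,\Delta\,\tau^2$$ for some $m\in\mathbb{Z}$, some integer $k\ge 1$ and some $i_1,\dots,i_k\in\{1,2,3\}$.
   Context: $B_4$ is the braid group on four strands with standard generators $\sigma_1,\sigma_2,\sigma_3$ and relations $\sigma_1\sigma_2\sigma_1=\sigma_2\sigma_1\sigma_2$, $\sigma_2\sigma_3\sigma_2=\sigma_3\sigma_2\sigma_3$, $\sigma_1\sigma_3=\sigma_3\sigma_1$. The element $\theta=\tau^4=\Delta^2$ is the generator of the (infinite cyclic) center $Z$ of $B_4$. The reduced Burau representation $\rho_4$ is given on generators by $$\rho_4(\sigma_1)=\begin{bmatrix}-t&t&0\\0&1&0\\0&0&1\end{bmatrix},\quad \rho_4(\sigma_2)=\begin{bmatrix}1&0&0\\1&-t&t\\0&0&1\end{bmatrix},\quad \rho_4(\sigma_3)=\begin{bmatrix}1&0&0\\0&1&0\\0&1&-t\end{bmatrix}.$$ The convention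 is ''left multiplication of matrices'': the matrix of a product of braids is formed by successively multiplying on the left, i.e. in terms of the ordinary matrix product $\rho_4(xy)=\rho_4(y)\rho_4(x)$ for all $x,y\in B_4$ (equivalently, $\rho_4$ is a homomorphism into $GL(3,\mathbb{Z}[t,t^{-1}])$ with the opposite multiplication). *)

(* Defs.v *)
From HB Require Import structures.
From mathcomp Require Import all_boot all_order all_algebra.
From mathcomp Require Import boolp.
From mathcomp Require Import ring.

Set Implicit Arguments.
Unset Strict Implicit.
Unset Printing Implicit Defensive.

Import GRing.Theory.

(* A letter (i, false) stands for the generator sigma_(i+1), and (i, true) for
   its formal inverse. *)
Definition letter : Type := ('I_3 * bool)%type.
Definition word : Type := seq letter.

Definition inv_letter (a : letter) : letter := (a.1, ~~ a.2).
Definition inv_word (w : word) : word := rev (map inv_letter w).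

Definition l1 : letter := (@Ordinal 3 0 isT, false).
Definition l2 : letter := (@Ordinal 3 1 isT, false).
Definition l3 : letter := (@Ordinal 3 2 isT, false).

Inductive braid_equiv : word -> word -> Prop :=
| BraidRefl w : braid_equiv w w
| BraidSym u v : braid_equiv u v -> braid_equiv v u
| BraidTrans u v w : braid_equiv u v -> braid_equiv v w -> braid_equiv u w
| BraidCat u u' v v' :
    braid_equiv u u' -> braid_equiv v v' -> braid_equiv (u ++ v) (u' ++ v')
| BraidCancel a : braid_equiv [:: a; inv_letter a] [::]
| Braid12 : braid_equiv [:: l1; l2; l1] [:: l2; l1; l2]
| Braid23 : braid_equiv [:: l2; l3; l2] [:: l3; l2; l3]
| Braid13 : braid_equiv [:: l1; l3] [:: l3; l1].

Definition braid_rel : rel word := fun u v => `[< braid_equiv u v >].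

Lemma braid_rel_refl : reflexive braid_rel.
Proof. by move=> w; apply/asboolP; exact: BraidRefl. Qed.

Lemma braid_rel_sym : symmetric braid_rel.
Proof. by move=> u v; apply/asboolP/asboolP; exact: BraidSym. Qed.

Lemma braid_rel_trans : transitive braid_rel.
Proof.
by move=> v u w /asboolP uv /asboolP vw; apply/asboolP; exact: BraidTrans uv vw.
Qed.

Canonical braid_equivRel :=
  EquivRel braid_rel braid_rel_refl braid_rel_sym braid_rel_trans.

Definition B4 : Type := {eq_quot braid_equivRel}%qT.
HB.instance Definition _ := EqQuotient.on B4.
HB.instance Definition _ := Choice.on B4.

Definition B4_of_word (w : word) : B4 := (\pi_B4 w)%qT.

Lemma B4_of_wordP u v : B4_of_word u = B4_of_word v <-> braid_equiv u v.
Proof.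
split=> [/eqmodP/asboolP // | uv].
by apply/eqmodP/asboolP.
Qed.

Lemma B4_of_wordK x : B4_of_word (repr x) = x.
Proof. exact: reprK. Qed.

Lemma repr_B4 w : braid_equiv (repr (B4_of_word w)) w.
Proof. by apply/B4_of_wordP; rewrite B4_of_wordK. Qed.

Lemma inv_letterK : involutive inv_letter.
Proof. by case=> i b; rewrite /inv_letter /= negbK. Qed.

Lemma inv_wordK : involutive inv_word.
Proof.
move=> w; rewrite /inv_word map_rev revK -map_comp -[RHS]map_id.
by apply: eq_map => a /=; rewrite inv_letterK.
Qed.

Lemma inv_word_cat u v : inv_word (u ++ v) = inv_word v ++ inv_word u.
Proof. by rewrite /inv_word map_cat rev_cat. Qed.

Lemma word_mulV w : braid_equiv (w ++ inv_word w) [::].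
Proof.
elim: w => [|a w IHw]; first exact: BraidRefl.
rewrite -[a :: w]cat1s inv_word_cat catA -(catA [:: a]).
apply: BraidTrans (BraidCancel a); rewrite -[X in _ ++ X]/([:: inv_letter a]).
rewrite -[X in braid_equiv _ X]/([:: a] ++ [:: inv_letter a]).
apply: BraidCat; last exact: BraidRefl.
rewrite -[X in braid_equiv _ X]cats0.
by apply: BraidCat; first exact: BraidRefl.
Qed.

Lemma word_mulVl w : braid_equiv (inv_word w ++ w) [::].
Proof. by rewrite -{2}[w]inv_wordK; exact: word_mulV. Qed.

Lemma braid_equiv_inv u v :
  braid_equiv u v -> braid_equiv (inv_word u) (inv_word v).
Proof.
move=> uv; apply: (@BraidTrans _ (inv_word u ++ (v ++ inv_word v))).
  rewrite -[X in braid_equiv X]cats0; apply: BraidCat; first exact: BraidRefl.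
  exact/BraidSym/word_mulV.
rewrite catA -[X in braid_equiv _ X]cat0s.
apply: BraidCat; last exact: BraidRefl.
apply: BraidTrans (word_mulVl u); apply: BraidCat; first exact: BraidRefl.
exact: BraidSym.
Qed.

Definition B4_one : B4 := B4_of_word [::].
Definition B4_mul (x y : B4) : B4 := B4_of_word (repr x ++ repr y).
Definition B4_inv (x : B4) : B4 := B4_of_word (inv_word (repr x)).

Lemma B4_mulE u v : B4_mul (B4_of_word u) (B4_of_word v) = B4_of_word (u ++ v).
Proof. by apply/B4_of_wordP; apply: BraidCat; exact: repr_B4. Qed.

Lemma B4_invE u : B4_inv (B4_of_word u) = B4_of_word (inv_word u).
Proof. by apply/B4_of_wordP/braid_equiv_inv/repr_B4. Qed.

Lemma B4_mulA : associative B4_mul.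
Proof.
move=> x y z; rewrite -(B4_of_wordK x) -(B4_of_wordK y) -(B4_of_wordK z).
by rewrite !B4_mulE catA.
Qed.

Lemma B4_mul1 : left_id B4_one B4_mul.
Proof. by move=> x; rewrite -(B4_of_wordK x) B4_mulE. Qed.

Lemma B4_1mul : right_id B4_one B4_mul.
Proof. by move=> x; rewrite -(B4_of_wordK x) B4_mulE cats0. Qed.

Lemma B4_mulV : left_inverse B4_one B4_inv B4_mul.
Proof.
move=> x; rewrite -(B4_of_wordK x) B4_invE B4_mulE.
exact/B4_of_wordP/word_mulVl.
Qed.

Lemma B4_Vmul : right_inverse B4_one B4_inv B4_mul.
Proof.
move=> x; rewrite -(B4_of_wordK x) B4_invE B4_mulE.
exact/B4_of_wordP/word_mulV.
Qed.

HB.instance Definition _ :=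
  isGroup.Build B4 B4_mulA B4_mul1 B4_1mul B4_mulV B4_Vmul.

Lemma B4_of_word_nil : B4_of_word [::] = 1%g.
Proof. by []. Qed.

Lemma B4_of_word_cat u v :
  B4_of_word (u ++ v) = (B4_of_word u * B4_of_word v)%g.
Proof. exact: esym (B4_mulE u v). Qed.

Lemma B4_of_word_inv u : B4_of_word (inv_word u) = ((B4_of_word u)^-1)%g.
Proof. exact: esym (B4_invE u). Qed.

Section IntegerPowers.
Local Open Scope group_scope.

Definition expgz (G : groupType) (x : G) (m : int) : G :=
  match m with Posz n => x ^+ n | Negz n => x ^- n.+1 end.

End IntegerPowers.

(* The intersection of all subgroups of G containing X. *)
Definition generated (G : groupType) (X : {pred G}) : {pred G} :=
  fun x => `[< forall S : {pred G},
    group_closed S -> {subset X <= S} -> x \in S >].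

Lemma generated_closed (G : groupType) (X : {pred G}) :
  group_closed (generated X).
Proof.
split=> [|x y /asboolP xX /asboolP yX]; apply/asboolP => S SG XS.
  by case: SG.
by case: (SG) => _; apply; [apply: xX | apply: yX].
Qed.

Lemma generated_gen (G : groupType) (X : {pred G}) : {subset X <= generated X}.
Proof. by move=> x xX; apply/asboolP => S _; apply. Qed.

Section Elements.
Local Open Scope group_scope.

Definition sigma1 : B4 := B4_of_word [:: l1].
Definition sigma2 : B4 := B4_of_word [:: l2].
Definition sigma3 : B4 := B4_of_word [:: l3].

Definition tau : B4 := sigma1 * sigma2 * sigma3.
Definition Delta : B4 := sigma1 * sigma2 * sigma3 * sigma1 * sigma2 * sigma1.
Definition theta : B4 := tau ^+ 4.

Lemma sigma_braid12 : sigma1 * sigma2 * sigma1 = sigma2 * sigma1 * sigma2.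
Proof.
rewrite -(B4_of_word_cat [:: l1] [:: l2]) -(B4_of_word_cat [:: l2] [:: l1]).
rewrite -(B4_of_word_cat [:: l1; l2] [:: l1]).
rewrite -(B4_of_word_cat [:: l2; l1] [:: l2]).
by apply/B4_of_wordP; exact: Braid12.
Qed.

Lemma sigma_braid23 : sigma2 * sigma3 * sigma2 = sigma3 * sigma2 * sigma3.
Proof.
rewrite -(B4_of_word_cat [:: l2] [:: l3]) -(B4_of_word_cat [:: l3] [:: l2]).
rewrite -(B4_of_word_cat [:: l2; l3] [:: l2]).
rewrite -(B4_of_word_cat [:: l3; l2] [:: l3]).
by apply/B4_of_wordP; exact: Braid23.
Qed.

Lemma sigma_comm13 : sigma1 * sigma3 = sigma3 * sigma1.
Proof.
rewrite -(B4_of_word_cat [:: l1] [:: l3]) -(B4_of_word_cat [:: l3] [:: l1]).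
by apply/B4_of_wordP; exact: Braid13.
Qed.

Lemma thetaE : theta = Delta ^+ 2.
Proof.
pose a := sigma1; pose b := sigma2; pose c := sigma3.
have E12 x : b * (a * (b * x)) = a * (b * (a * x)).
  by rewrite !mulgA sigma_braid12.
have E23 x : c * (b * (c * x)) = b * (c * (b * x)).
  by rewrite !mulgA sigma_braid23.
have E13 x : c * (a * x) = a * (c * x) by rewrite !mulgA sigma_comm13.
have E : c * (a * (b * (c * (a * (b * c))))) = a * (a * (b * (c * (a * (b * a))))).
  rewrite E13 E23; congr (a * _).
  by rewrite E12 E13 [a * c]sigma_comm13 E23 E12 -E13.
rewrite /theta /Delta /tau -/a -/b -/c !expgS expg0 !mulg1 -!mulgA.
by rewrite E.
Qed.

End Elements.

Local Open Scope ring_scope.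

Notation fracX := (FracField.tofrac ('X : {poly int})).

(* Z[t, t^-1], realized inside the fraction field of Z[t] as the subring of the
   fractions p / t^n. *)
Definition laurent_pred : {pred {fraction {poly int}}} :=
  fun x => `[< exists (p : {poly int}) (n : nat),
    x = FracField.tofrac p / fracX ^+ n >].

Lemma fracX_neq0 : fracX != 0.
Proof. by rewrite tofrac_eq0 polyX_eq0. Qed.

Lemma laurent_subring : subring_closed laurent_pred.
Proof.
have Xn n : fracX ^+ n != 0 by rewrite expf_neq0 // fracX_neq0.
split=> [|_ _ /asboolP[p [m ->]] /asboolP[q [n ->]]
         |_ _ /asboolP[p [m ->]] /asboolP[q [n ->]]]; apply/asboolP.
- by exists 1, 0; rewrite tofrac1 expr0 divr1.
- exists (p * 'X^n - q * 'X^m), (m + n)%N.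
  by rewrite tofracB !tofracM !tofracXn exprD -mulNr addf_div ?Xn // mulNr.
- by exists (p * q), (m + n)%N; rewrite tofracM exprD mulf_div.
Qed.

HB.instance Definition _ :=
  GRing.isSubringClosed.Build _ laurent_pred laurent_subring.

Record laurent : Type := Laurent {
  laurent_val :> {fraction {poly int}};
  laurent_valP : laurent_val \in laurent_pred
}.

HB.instance Definition _ := [isSub for laurent_val].
HB.instance Definition _ := [Choice of laurent by <:].
HB.instance Definition _ := [SubChoice_isSubComNzRing of laurent by <:].

Definition laurent_unit : {pred laurent} :=
  fun x => (x != 0) && ((val x)^-1 \in laurent_pred).
Definition laurent_inv (x : laurent) : laurent := insubd x (val x)^-1.

Lemma laurent_val0 : laurent_val 0 = 0.
Proof. by []. Qed.

Lemma laurent_val1 : laurent_val 1 = 1.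
Proof. by []. Qed.

Lemma laurent_valM x y : laurent_val (x * y) = laurent_val x * laurent_val y.
Proof. by []. Qed.

Lemma laurent_inj : injective laurent_val.
Proof. exact: val_inj. Qed.

Lemma laurent_mulVx : {in laurent_unit, left_inverse 1 laurent_inv *%R}.
Proof.
move=> x /andP[x0 xV]; apply: laurent_inj.
have -> : laurent_inv x = Laurent xV.
  by apply: laurent_inj; exact: insubdK.
rewrite laurent_valM laurent_val1; apply: mulVf.
by apply: contra_neq x0 => x0; exact: laurent_inj.
Qed.

Lemma laurent_unitPl x y : y * x = 1 -> laurent_unit x.
Proof.
move=> yx; have yx1 : laurent_val y * laurent_val x = 1.
  by rewrite -laurent_valM yx.
have x0 : laurent_val x != 0.
  by apply: contra_eq_neq yx1 => ->; rewrite mulr0 eq_sym oner_neq0.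
apply/andP; split; first by apply: contra_neq x0 => ->.
have -> : (val x)^-1 = laurent_val y
  by apply: mulr1_eq; rewrite mulrC.
exact: laurent_valP.
Qed.

Lemma laurent_invr_out : {in [predC laurent_unit], laurent_inv =1 id}.
Proof.
move=> x; rewrite inE negb_and negbK => /orP[/eqP x0|xV].
  have V0 : (laurent_val x)^-1 = laurent_val x by rewrite x0 laurent_val0 invr0.
  by rewrite /laurent_inv V0 valKd.
by rewrite /laurent_inv /insubd insubN.
Qed.

HB.instance Definition _ := GRing.ComNzRing_hasMulInverse.Build laurent
  laurent_mulVx laurent_unitPl laurent_invr_out.

Lemma laurent_t_subproof : fracX \in laurent_pred.
Proof. by apply/asboolP; exists 'X, 0; rewrite expr0 divr1. Qed.

Definition t : laurent := Laurent laurent_t_subproof.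

Lemma t_unit : t \is a GRing.unit.
Proof.
apply/andP; split; first by apply: contra_neq fracX_neq0 => /(congr1 val).
by apply/asboolP; exists 1, 1; rewrite tofrac1 expr1 div1r.
Qed.

Definition mx3 (s : seq (seq laurent)) : 'M[laurent]_3 :=
  \matrix_(i, j) nth 0 (nth [::] s i) j.

Definition burau_sigma (i : 'I_3) : 'M[laurent]_3 :=
  match val i with
  | 0 => mx3 [:: [:: -t; t; 0]; [:: 0; 1; 0]; [:: 0; 0; 1]]
  | 1 => mx3 [:: [:: 1; 0; 0]; [:: 1; -t; t]; [:: 0; 0; 1]]
  | _ => mx3 [:: [:: 1; 0; 0]; [:: 0; 1; 0]; [:: 0; 1; -t]]
  end.

Definition burau_letter (a : letter) : 'M[laurent]_3 :=
  if a.2 then invmx (burau_sigma a.1) else burau_sigma a.1.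

(* The matrices of successive letters are multiplied on the left. *)
Fixpoint burau_word (w : word) : 'M[laurent]_3 :=
  if w is a :: w' then burau_word w' *m burau_letter a else 1%:M.

(* A homomorphism into the opposite of GL(3, Z[t, t^-1]): see rho4M and
   rho4_unit. Its value does not depend on the chosen representative: see
   rho4E. *)
Definition rho4 (x : B4) : 'M[laurent]_3 := burau_word (repr x).

Lemma mx3M (a b c d e f g h i a' b' c' d' e' f' g' h' i' : laurent) :
  mx3 [:: [:: a; b; c]; [:: d; e; f]; [:: g; h; i]] *m
  mx3 [:: [:: a'; b'; c']; [:: d'; e'; f']; [:: g'; h'; i']] =
  mx3 [:: [:: a * a' + b * d' + c * g'; a * b' + b * e' + c * h';
              a * c' + b * f' + c * i'];
          [:: d * a' + e * d' + f * g'; d * b' + e * e' + f * h';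
              d * c' + e * f' + f * i'];
          [:: g * a' + h * d' + i * g'; g * b' + h * e' + i * h';
              g * c' + h * f' + i * i']].
Proof.
apply/matrixP=> x y; rewrite !mxE !big_ord_recl big_ord0 !mxE addr0 addrA.
by case: x => [[|[|[|//]]] ?]; case: y => [[|[|[|//]]] ?].
Qed.

Lemma mx3_1 : mx3 [:: [:: 1; 0; 0]; [:: 0; 1; 0]; [:: 0; 0; 1]] = 1%:M.
Proof.
apply/matrixP=> x y; rewrite !mxE.
by case: x => [[|[|[|//]]] ?]; case: y => [[|[|[|//]]] ?].
Qed.

Lemma burau_sigma_unit i : burau_sigma i \in unitmx.
Proof.
have tV : t * t^-1 = 1 by rewrite divrr ?t_unit.
case: i => [[|[|[|//]]] lti].
- suff /mulmx1_unit[] : burau_sigma (Ordinal lti) *m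
    mx3 [:: [:: - t^-1; 1; 0]; [:: 0; 1; 0]; [:: 0; 0; 1]] = 1%:M by [].
  rewrite /burau_sigma /= mx3M -mx3_1.
  by congr mx3; do ![congr (_ :: _)]; ring: tV.
- suff /mulmx1_unit[] : burau_sigma (Ordinal lti) *m
    mx3 [:: [:: 1; 0; 0]; [:: t^-1; - t^-1; 1]; [:: 0; 0; 1]] = 1%:M by [].
  rewrite /burau_sigma /= mx3M -mx3_1.
  by congr mx3; do ![congr (_ :: _)]; ring: tV.
- suff /mulmx1_unit[] : burau_sigma (Ordinal lti) *m
    mx3 [:: [:: 1; 0; 0]; [:: 0; 1; 0]; [:: 0; t^-1; - t^-1]] = 1%:M by [].
  rewrite /burau_sigma /= mx3M -mx3_1.
  by congr mx3; do ![congr (_ :: _)]; ring: tV.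
Qed.

Lemma burau_letter_unit a : burau_letter a \in unitmx.
Proof.
by rewrite /burau_letter; case: a.2; rewrite ?unitmx_inv burau_sigma_unit.
Qed.

Lemma burau_word_unit w : burau_word w \in unitmx.
Proof.
elim: w => [|a w IHw] /=; first exact: unitmx1.
by rewrite unitmx_mul IHw burau_letter_unit.
Qed.

Lemma burau_word_cat u v : burau_word (u ++ v) = burau_word v *m burau_word u.
Proof. by elim: u => [|a u IHu] /=; rewrite ?mulmx1 // IHu mulmxA. Qed.

Lemma burau_word_equiv u v : braid_equiv u v -> burau_word u = burau_word v.
Proof.
elim=> {u v} [//|u v _ -> //|u v w _ -> //|u u' v v' _ uu' _ vv'|[i b]| | |].
- by rewrite !burau_word_cat uu' vv'.
- rewrite /= mul1mx /burau_letter /=.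
  by case: b; rewrite /= ?mulmxV ?mulVmx // burau_sigma_unit.
- rewrite /= !mul1mx /burau_letter /= /burau_sigma /= !mx3M.
  by congr mx3; do ![congr (_ :: _)]; ring.
- rewrite /= !mul1mx /burau_letter /= /burau_sigma /= !mx3M.
  by congr mx3; do ![congr (_ :: _)]; ring.
- rewrite /= !mul1mx /burau_letter /= /burau_sigma /= !mx3M.
  by congr mx3; do ![congr (_ :: _)]; ring.
Qed.

Lemma rho4E w : rho4 (B4_of_word w) = burau_word w.
Proof. exact/burau_word_equiv/repr_B4. Qed.

Lemma rho4_1 : rho4 1%g = 1%:M.
Proof. by rewrite -B4_of_word_nil rho4E. Qed.

Lemma rho4M x y : rho4 (x * y)%g = rho4 y *m rho4 x.
Proof.
rewrite -(B4_of_wordK x) -(B4_of_wordK y) -B4_of_word_cat !rho4E.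
exact: burau_word_cat.
Qed.

Lemma rho4_unit x : rho4 x \in unitmx.
Proof. exact: burau_word_unit. Qed.

Lemma rho4_sigma1 :
  rho4 sigma1 = mx3 [:: [:: -t; t; 0]; [:: 0; 1; 0]; [:: 0; 0; 1]].
Proof. by rewrite rho4E /= mul1mx. Qed.

Lemma rho4_sigma2 :
  rho4 sigma2 = mx3 [:: [:: 1; 0; 0]; [:: 1; -t; t]; [:: 0; 0; 1]].
Proof. by rewrite rho4E /= mul1mx. Qed.

Lemma rho4_sigma3 :
  rho4 sigma3 = mx3 [:: [:: 1; 0; 0]; [:: 0; 1; 0]; [:: 0; 1; -t]].
Proof. by rewrite rho4E /= mul1mx. Qed.

Definition burau_kernel : {pred B4} := fun x => rho4 x == 1%:M.

(* Main.v *)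
Require Import Defs.
From HB Require Import structures.
From mathcomp Require Import all_boot all_order all_algebra.
From mathcomp Require Import boolp ring zify.

(** Containment in <tau, Delta>. At t = -1 every generator of the reduced
    Burau representation fixes the column (1, 0, 1), so the representation
    preserves the plane of rows (x, y, -x). This gives an action of the braid
    group on pairs of integers in which sigma1 and sigma3 act by
    (x, y) |-> (x, y - x) and sigma2 by (x, y) |-> (x + y, y), and kernel
    elements act trivially ([act_kernel]). It remains to see that a braid acting
    trivially lies in <tau, Delta>, and for this a normal form and a ping-pong
    argument suffice.

    The normal form: the subgroup N generated by sigma1 sigma3^-1, its
    conjugate by tau, and tau^2 is normal ([modular_kernelJ]) and contained in
    <tau, Delta>. Modulo N, sigma1 = sigma3, and the elements
    s = sigma1 sigma2 sigma1 and u = sigma1 sigma2 satisfy s^2 = u^3 = 1 and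
    generate everything. Alternating words in s and u, regrouped using
    sigma1 = u^-1 s and sigma2^-1 = u s^-1, show that every braid is
    g P u^j with g in <tau, Delta>, P a product of letters sigma1 and
    sigma2^-1, and 0 <= j <= 2 ([coset_formP]).

    The ping-pong: tau and Delta act by (x, y) |-> (y, -x) and (x, y) |->
    (-x, -y), so <tau, Delta> preserves |x| + |y|, whereas each letter of P
    strictly increases |x| + |y| on the quadrant x > 0 > y
    ([norm1_pos_prod]). If g P u^j acts trivially, comparing norms of the
    images of (1, -1) and (1, 1) leaves only P = 1 and j = 0
    ([burau_kernel_sub]).

    The shape of a nontrivial kernel element. As tau^4 = Delta^2 = theta is
    central, an element of <tau, Delta> is a power of theta times an
    alternating product of Delta and of tau, tau^2, tau^3. Conjugation brings
    it to theta^m, to theta^m Delta, or to theta^m times a product that both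
    starts and ends with a power of tau ([conj_alternating_form]). The first is
    excluded for nontrivial kernel elements because the matrix of theta is the
    scalar t^4 ([theta_expgz_kernel]), the second because theta^m Delta acts on
    pairs of integers as -1 ([theta_Delta_kernel]). Conjugating the third by
    tau^2 Delta, whose inverse is Delta tau^2 up to theta, produces the required
    form ([conj_sandwich]). *)

Set Implicit Arguments.
Unset Strict Implicit.
Unset Printing Implicit Defensive.

Import GRing.Theory Num.Theory.

Local Open Scope group_scope.

(** * Induction in generated subgroups and in the braid group *)

HB.instance Definition _ (G : groupType) (X : {pred G}) :=
  isInvClosed.Build G (generated X) (group_closedV (generated_closed X)).
HB.instance Definition _ (G : groupType) (X : {pred G}) :=
  isMulClosed.Build G (generated X) (group_closedM (generated_closed X)).
HB.instance Definition _ (G : groupType) (X : {pred G}) :=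
  isMul1Closed.Build G (generated X) (proj1 (generated_closed X)).

Lemma generated_sub (G : groupType) (X S : {pred G}) :
  group_closed S -> {subset X <= S} -> {subset generated X <= S}.
Proof. by move=> SG XS x /asboolP; apply. Qed.

(** Right multiplications by generators and their inverses suffice: the elements
    that preserve [P] by right multiplication, together with their inverses,
    form a subgroup. *)
Lemma generated_ind (G : groupType) (X : {pred G}) (P : G -> Prop) :
    P 1 -> (forall x y, P x -> y \in X -> P (x * y)) ->
    (forall x y, P x -> y \in X -> P (x * y^-1)) ->
  forall x, x \in generated X -> P x.
Proof.
move=> P1 PM PV x /asboolP xX.
pose S : {pred G} :=
  fun y => `[< forall z, P z -> P (z * y) /\ P (z * y^-1) >].
suff /asboolP/(_ 1 P1)[] : x \in S by rewrite mul1g.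
apply: xX => [|y yX]; last first.
  by apply/asboolP => z Pz; split; [apply: PM | apply: PV].
split; first by apply/asboolP => z; rewrite invg1 mulg1.
move=> y z /asboolP Sy /asboolP Sz; apply/asboolP => u Pu.
split; first by rewrite mulgA; apply Sz; apply Sy.
by rewrite invgF mulgA; apply Sy; apply Sz.
Qed.

Lemma B4_ind (P : B4 -> Prop) :
    P 1 -> (forall x y, P x -> y \in pred3 sigma1 sigma2 sigma3 -> P (x * y)) ->
    (forall x y, P x -> y \in pred3 sigma1 sigma2 sigma3 -> P (x * y^-1)) ->
  forall x, P x.
Proof.
move=> P1 PM PV x; rewrite -(B4_of_wordK x); move: (repr x) => {x}.
elim/last_ind => [//|w [i e] IHw].
have is_gen : B4_of_word [:: (i, false)] \in pred3 sigma1 sigma2 sigma3.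
  case: i => [[|[|[|//]]] i3]; rewrite !inE.
  - by rewrite (_ : Ordinal i3 = @Ordinal 3 0 isT) ?eqxx //; apply: val_inj.
  - rewrite (_ : Ordinal i3 = @Ordinal 3 1 isT) ?eqxx ?orbT //.
    exact: val_inj.
  - rewrite (_ : Ordinal i3 = @Ordinal 3 2 isT) ?eqxx ?orbT //.
    exact: val_inj.
rewrite -cats1 B4_of_word_cat; case: e; last exact: PM.
by rewrite -[[:: _]]/(inv_word [:: (i, false)]) B4_of_word_inv; apply: PV.
Qed.

(** * A normal subgroup with quotient the modular group *)

(** The computations below use nothing but the braid relations. They are stated
    for arbitrary elements of a group so that [t], the product of the three
    generators, stays an atom instead of being unfolded by rewriting. *)
Section BraidCalculus.
Variables (G : groupType) (a b c : G).
Hypotheses (braid_ab : a * b * a = b * a * b).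
Hypotheses (braid_bc : b * c * b = c * b * c).
Hypothesis comm_ac : a * c = c * a.
Variable t : G.
Hypothesis def_t : t = a * b * c.
Let p := a * c^-1.

Let aba x : b * (a * (b * x)) = a * (b * (a * x)).
Proof. by rewrite !mulgA braid_ab. Qed.
Let bcb x : c * (b * (c * x)) = b * (c * (b * x)).
Proof. by rewrite !mulgA braid_bc. Qed.
Let ca x : c * (a * x) = a * (c * x).
Proof. by rewrite !mulgA comm_ac. Qed.
Let tE x : t * x = a * (b * (c * x)).
Proof. by rewrite def_t -!mulgA. Qed.

Lemma coxeter_mul1 : t * a = b * t.
Proof. by rewrite tE def_t -comm_ac !mulgA braid_ab. Qed.

Lemma coxeter_mul2 : t * b = c * t.
Proof. by rewrite tE (mulgA b) braid_bc def_t !mulgA comm_ac. Qed.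

Lemma coxeter2_mul1 : t ^+ 2 * a = c * t ^+ 2.
Proof. by rewrite expg2 -mulgA coxeter_mul1 mulgA coxeter_mul2 mulgA. Qed.

Lemma coxeter2_mul3 : t ^+ 2 * c = a * t ^+ 2.
Proof.
by rewrite expg2 -mulgA !tE def_t -mulgA [in RHS]ca -aba -bcb -ca.
Qed.

Lemma garside_coxeter : a * b * c * a * b * a = t ^+ 2 * p.
Proof.
rewrite mulgA coxeter2_mul1; apply: (mulIg c); rewrite mulgVK expg2 tE def_t.
by rewrite -!mulgA [in RHS]ca bcb aba.
Qed.

Lemma half_twist_coxeter : a * b * a = t * p.
Proof. by rewrite def_t /p -[RHS]mulgA (mulgA c) -comm_ac mulgK. Qed.

Let cV x : c^-1 * (a * x) = a * (c^-1 * x).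
Proof. by apply: (mulgI c); rewrite mulVKg ca mulVKg. Qed.

Lemma fiberX_conj1 : p ^ a = p.
Proof. by rewrite conjgE -mulgA mulKg -[a in LHS]mulg1 cV mulg1. Qed.

Lemma coxeter2_conj1 : (t ^+ 2) ^ a = t ^+ 2 * p.
Proof.
move: (t ^+ 2) coxeter2_mul3 => T Tc.
have AT : a^-1 * T = T * c^-1.
  by apply: (mulgI a); rewrite mulVKg mulgA -Tc mulgK.
by rewrite conjgE mulgA AT -mulgA /p -[a in LHS]mulg1 cV mulg1.
Qed.

Let r := p ^ t.

Let conj_eq (x y z : G) : x * y = z * x -> z ^ x = y.
Proof. by move=> xy; rewrite conjgE -xy mulKg. Qed.

Lemma fiberY_conj_coxeter : r ^ t = p^-1.
Proof.
rewrite /r -conjgM -expg2 conjMg conjVg (conj_eq coxeter2_mul3).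
by rewrite (conj_eq coxeter2_mul1) invgM invgK.
Qed.

Lemma fiberY_conj1 : r ^ a = p^-1 * r.
Proof.
have rE : r = a * (b * (c * (b^-1 * (a^-1 * b^-1)))).
  (* The conjugate of a by t is an explicit conjugate of c. *)
  have conj_a : t * (a * b * c * b^-1 * a^-1) = a * t.
    rewrite !mulgA; do 2!apply: (canLR (mulgK _)).
    by rewrite def_t -!mulgA ca (mulgA c b c) -braid_bc -!mulgA aba [in RHS]ca.
  by rewrite /r conjMg conjVg (conj_eq coxeter_mul2) (conj_eq conj_a) -!mulgA.
have BAB : b^-1 * (a^-1 * b^-1) = a^-1 * (b^-1 * a^-1).
  by rewrite -!invgM braid_ab.
rewrite BAB in rE; rewrite conjgE {1}rE -!mulgA mulVg mulg1 mulKg.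
by rewrite /p invgM invgK rE -BAB -mulgA mulKg !mulgA -braid_bc mulgK.
Qed.

End BraidCalculus.

(** The elements [fiberX] and [fiberY] freely generate the kernel of the
    projection onto the three-strand braid group that identifies [sigma3] with
    [sigma1]. *)
Definition fiberX : B4 := sigma1 * sigma3^-1.
Definition fiberY : B4 := fiberX ^ tau.

(** The square of [tau] projects to the square of the three-strand half twist,
    so the quotient by this subgroup is the modular group. *)
Definition modular_kernel : {pred B4} :=
  generated (pred3 fiberX fiberY (tau ^+ 2)).

Definition tauDelta : {pred B4} := generated (pred2 tau Delta).

Definition tauE : tau = sigma1 * sigma2 * sigma3 := erefl.

Lemma tau2J : (tau ^+ 2) ^ tau = tau ^+ 2.
Proof. by rewrite conjXg conjgE mulKg. Qed.

Lemma modular_kernel_gen x :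
  x \in pred3 fiberX fiberY (tau ^+ 2) -> x \in modular_kernel.
Proof. exact: generated_gen. Qed.

Lemma fiberX_in : fiberX \in modular_kernel.
Proof. by apply: modular_kernel_gen; rewrite !inE eqxx. Qed.

Lemma fiberY_in : fiberY \in modular_kernel.
Proof. by apply: modular_kernel_gen; rewrite !inE eqxx orbT. Qed.

Lemma tau2_in : tau ^+ 2 \in modular_kernel.
Proof. by apply: modular_kernel_gen; rewrite !inE eqxx !orbT. Qed.

#[local] Hint Resolve fiberX_in fiberY_in tau2_in : core.

Lemma DeltaE : Delta = tau ^+ 2 * fiberX.
Proof.
exact (garside_coxeter sigma_braid12 sigma_braid23 sigma_comm13 tauE).
Qed.

(** As [Delta] is the product of the square of [tau] and [fiberX], the subgroup
    generated by [tau] and [Delta] is also generated by [tau] and [fiberX]. *)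
Lemma modular_kernel_sub : {subset modular_kernel <= tauDelta}.
Proof.
have tauG : tau \in tauDelta by apply: generated_gen; rewrite !inE eqxx.
have DeltaG : Delta \in tauDelta.
  by apply: generated_gen; rewrite !inE eqxx orbT.
have p1G : fiberX \in tauDelta.
  rewrite -(mulKg (tau ^+ 2) fiberX) -DeltaE.
  by apply: gpredM => //; apply/gpredVr/gpredXn.
apply: generated_sub; first exact: generated_closed.
move=> x; rewrite !inE => /or3P[] /eqP-> //; last exact: gpredXn.
exact: gpredJ.
Qed.

Lemma modular_kernelJ_gen (y : B4) :
    fiberX ^ y \in modular_kernel -> fiberY ^ y \in modular_kernel ->
    (tau ^+ 2) ^ y \in modular_kernel ->
  forall x, x \in modular_kernel -> x ^ y \in modular_kernel.
Proof.
move=> y1 y2 y3.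
apply: generated_ind => [|x z xy zX|x z xy zX]; first by rewrite conj1g gpred1.
  by rewrite conjMg gpredM //; move: zX; rewrite !inE => /or3P[] /eqP->.
rewrite conjMg conjVg gpredM // gpredVr //; move: zX.
by rewrite !inE => /or3P[] /eqP->.
Qed.

Lemma conjgV_eq (x y z : B4) : x ^ y = z -> z ^ y^-1 = x.
Proof. by move<-; rewrite conjgK. Qed.

(** Conjugation by [tau] permutes [fiberX] and [fiberY] up to inversion and
    fixes the square of [tau]; conjugation by [sigma1] fixes [fiberX] and multiplies
    the two other generators by powers of it. The elements [tau] and [sigma1]
    generate the braid group, as conjugation by the inverse of [tau] sends
    [sigma1] to [sigma2] and [sigma2] to [sigma3]. *)
Lemma modular_kernelJ x y : x \in modular_kernel -> x ^ y \in modular_kernel.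
Proof.
have s1J : fiberX ^ sigma1 = fiberX := fiberX_conj1 sigma_comm13.
have s2J : fiberY ^ sigma1 = fiberX^-1 * fiberY.
  exact (fiberY_conj1 sigma_braid12 sigma_braid23 sigma_comm13 tauE).
have s3J : (tau ^+ 2) ^ sigma1 = tau ^+ 2 * fiberX.
  exact (coxeter2_conj1 sigma_braid12 sigma_braid23 sigma_comm13 tauE).
have t2J : fiberY ^ tau = fiberX^-1.
  exact (fiberY_conj_coxeter sigma_braid12 sigma_braid23 sigma_comm13 tauE).
pose normal := fun z =>
  forall x, x \in modular_kernel -> x ^ z \in modular_kernel.
have nM z1 z2 : normal z1 -> normal z2 -> normal (z1 * z2).
  by move=> n1 n2 u uF; rewrite conjgM; apply/n2/n1.
have nt : normal tau.
  by apply: modular_kernelJ_gen; rewrite // ?t2J ?tau2J // gpredVr.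
have ntV : normal tau^-1.
  apply: modular_kernelJ_gen.
  - by rewrite -[fiberX]invgK conjVg (conjgV_eq t2J) gpredVr.
  - by rewrite (conjgV_eq (erefl fiberY)).
  - by rewrite (conjgV_eq tau2J).
have n1 : normal sigma1.
  by apply: modular_kernelJ_gen; rewrite ?s1J ?s2J ?s3J // gpredM // gpredVr.
have s1V := conjgV_eq s1J.
have n1V : normal sigma1^-1.
  apply: modular_kernelJ_gen; rewrite ?s1V //.
  - by rewrite -[fiberY](mulVKg fiberX) conjMg s1V (conjgV_eq s2J) gpredM.
  - rewrite -[tau ^+ 2](mulgK fiberX) conjMg (conjgV_eq s3J) conjVg s1V.
    by rewrite gpredM // gpredVr.
have nJ z : normal z -> normal (z ^ tau^-1).
  by move=> nz; rewrite conjgE invgK; exact (nM _ _ nt (nM _ _ nz ntV)).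
have s2E : sigma1 ^ tau^-1 = sigma2.
  apply/conjgV_eq; rewrite conjgE.
  rewrite -(coxeter_mul1 sigma_braid12 sigma_comm13 tauE).
  by rewrite mulKg.
have s3E : sigma2 ^ tau^-1 = sigma3.
  apply/conjgV_eq; rewrite conjgE.
  rewrite -(coxeter_mul2 sigma_braid23 sigma_comm13 tauE).
  by rewrite mulKg.
have n2 : normal sigma2 by rewrite -s2E; apply: nJ.
have n2V : normal sigma2^-1 by rewrite -s2E -conjVg; apply: nJ.
have n3 : normal sigma3 by rewrite -s3E; apply: nJ.
have n3V : normal sigma3^-1 by rewrite -s3E -conjVg; apply: nJ.
move: y x; apply: B4_ind => [x xF|x y nx yS|x y nx yS]; first by rewrite conjg1.
- by apply: nM => //; move: yS; rewrite !inE => /or3P[] /eqP->.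
- by apply: nM => //; move: yS; rewrite !inE => /or3P[] /eqP->.
Qed.

(** * Representatives of the cosets of <tau, Delta> *)

Definition half_twist : B4 := sigma1 * sigma2 * sigma1.
Definition coxeter12 : B4 := sigma1 * sigma2.

(** The letters [sigma1] and the inverse of [sigma2] act on the plane by the two
    elementary unipotent matrices which, after a change of sign of one
    coordinate, have nonnegative entries. *)
Definition pos_prod (w : seq bool) : B4 :=
  \prod_(e <- w) (if e then sigma1 else sigma2^-1).

(** The normal form of elements of the free product of cyclic groups of orders
    2 and 3, generated by [half_twist] and [coxeter12] modulo
    [modular_kernel]: a letter of [pos_prod] is a syllable in [coxeter12]
    followed by [half_twist], the leading [half_twist] is absorbed in [g], and
    the trailing syllable is the power [j]. *)
Definition coset_form (x : B4) : Prop :=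
  exists (g : B4) (w : seq bool) (j : nat),
    [/\ g \in tauDelta, (j <= 2)%N & x = g * pos_prod w * coxeter12 ^+ j].

Lemma half_twistE : half_twist = tau * fiberX.
Proof. exact (half_twist_coxeter sigma_comm13 tauE). Qed.

Lemma half_twist2_in : half_twist ^+ 2 \in modular_kernel.
Proof.
have -> : half_twist ^+ 2 = tau ^+ 2 * (fiberY * fiberX).
  by rewrite half_twistE !expg2 mulgA -(mulgA tau) (conjgC fiberX) !mulgA.
by apply: gpredM => //; apply: gpredM.
Qed.

Lemma coxeter12_cube : coxeter12 ^+ 3 = half_twist ^+ 2.
Proof.
rewrite /half_twist expg2 [X in _ * X]sigma_braid12.
by rewrite !expgS expg0 mulg1 /coxeter12 !mulgA.
Qed.

Lemma pos_prod_rcons w e :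
  pos_prod (rcons w e) = pos_prod w * (if e then sigma1 else sigma2^-1).
Proof. by rewrite /pos_prod -cats1 big_cat big_seq1. Qed.

(** Normality moves a right factor in [modular_kernel] to the left, into the
    factor from <tau, Delta>. *)
Lemma coset_formM x y :
  y \in modular_kernel -> coset_form x -> coset_form (x * y).
Proof.
move=> yF [g [w [j [gG j2 ->]]]].
exists (g * y ^ (pos_prod w * coxeter12 ^+ j)^-1), w, j; split=> //.
  by apply: gpredM => //; apply/modular_kernel_sub/modular_kernelJ.
rewrite -(mulgA g) -[RHS]mulgA; set z := pos_prod w * coxeter12 ^+ j.
by rewrite -!(mulgA g) (conjgCV z).
Qed.

Lemma coset_form_coxeter12 x : coset_form x -> coset_form (x * coxeter12).
Proof.
move=> [g [w [j [gG j2 ->]]]]; rewrite -mulgA -expgSr.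
case: j j2 => [|[|[|//]]] _; [by exists g, w, 1%N | by exists g, w, 2 |].
rewrite coxeter12_cube; apply: coset_formM half_twist2_in _.
by exists g, w, 0; rewrite mulg1.
Qed.

Lemma coxeter12V_half_twist : coxeter12^-1 * half_twist = sigma1.
Proof. by rewrite /half_twist -/coxeter12 mulKg. Qed.

Lemma half_twist_coxeter12V : half_twist * coxeter12^-1 = sigma2.
Proof. by rewrite /half_twist sigma_braid12 -(mulgA sigma2) mulgK. Qed.

(** If [j] is nonzero, the last syllable and the new [half_twist] merge into a
    letter of [pos_prod]. If [j] is zero, the new [half_twist] cancels that of
    the last letter, or is absorbed on the left when there is no letter. *)
Lemma coset_form_half_twist x : coset_form x -> coset_form (x * half_twist).
Proof.
move=> [g [w [j [gG + ->]]]]; case: j => [|[|[|//]]] _.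
- rewrite mulg1; case/lastP: w => [|w e].
    exists (g * half_twist), [::], 0; split=> //.
      rewrite half_twistE; apply/gpredM => //; apply/gpredM.
        by apply: generated_gen; rewrite !inE eqxx.
      exact: modular_kernel_sub.
    by rewrite /pos_prod big_nil !mulg1.
  rewrite pos_prod_rcons; case: e; last first.
    exists g, w, 1%N; split=> //.
    by rewrite -half_twist_coxeter12V invgM invgK -!mulgA mulVg mulg1.
  exists g, w, 2; split=> //; rewrite -!mulgA; do 2!congr (_ * _).
  rewrite -{1}coxeter12V_half_twist -mulgA -expg2 -coxeter12_cube.
  by rewrite expgS mulKg.
- have e : coxeter12 ^+ 1 * half_twist = sigma2^-1 * half_twist ^+ 2.
    rewrite -half_twist_coxeter12V invgM invgK expg1 expg2.
    by rewrite -[RHS]mulgA mulKg.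
  rewrite -mulgA e mulgA; apply: coset_formM half_twist2_in _.
  by exists g, (rcons w false), 0; rewrite pos_prod_rcons mulg1 mulgA.
- have e : coxeter12 ^+ 2 * half_twist = sigma1 * (half_twist ^+ 2) ^ sigma1.
    rewrite -conjgC -coxeter12V_half_twist -coxeter12_cube (expgSr _ 2).
    by rewrite -[RHS]mulgA mulVKg.
  rewrite -mulgA e mulgA.
  apply: coset_formM (modular_kernelJ _ half_twist2_in) _.
  by exists g, (rcons w true), 0; rewrite pos_prod_rcons mulg1 mulgA.
Qed.

Lemma coset_form_half_twistV x : coset_form x -> coset_form (x * half_twist^-1).
Proof.
move=> /coset_form_half_twist xr.
rewrite (_ : half_twist^-1 = half_twist * half_twist ^- 2).
  by rewrite mulgA; apply: coset_formM xr; apply/gpredVr/half_twist2_in.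
by rewrite expg2 (invgM half_twist) mulVKg.
Qed.

Lemma coset_form_coxeter12V x : coset_form x -> coset_form (x * coxeter12^-1).
Proof.
move=> /coset_form_coxeter12/coset_form_coxeter12 xr.
rewrite (_ : coxeter12^-1 = coxeter12 * (coxeter12 * coxeter12 ^- 3)).
  rewrite 2!mulgA; apply: coset_formM xr; rewrite coxeter12_cube.
  exact/gpredVr/half_twist2_in.
by rewrite !expgSr expg0 mul1g (invgM _ coxeter12) (invgM coxeter12) !mulVKg.
Qed.

Lemma coset_formP x : coset_form x.
Proof.
have red_s1 y : coset_form y -> coset_form (y * sigma1).
  move=> yr; rewrite -coxeter12V_half_twist mulgA.
  exact/coset_form_half_twist/coset_form_coxeter12V.
have red_s1V y : coset_form y -> coset_form (y * sigma1^-1).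
  move=> yr; rewrite -coxeter12V_half_twist invgM invgK mulgA.
  exact/coset_form_coxeter12/coset_form_half_twistV.
have fV : fiberX^-1 \in modular_kernel by exact: gpredVr.
elim/B4_ind: x => [|y z yr|y z yr].
- exists 1, [::], 0; split; rewrite ?gpred1 //.
  by rewrite /pos_prod big_nil !mulg1.
- rewrite !inE => /or3P[] /eqP->; first exact: red_s1.
    rewrite -half_twist_coxeter12V mulgA.
    exact/coset_form_coxeter12V/coset_form_half_twist.
  have -> : sigma3 = fiberX^-1 * sigma1.
    by rewrite /fiberX invgM invgK mulgVK.
  by rewrite mulgA; apply/red_s1/coset_formM.
- rewrite !inE => /or3P[] /eqP->; first exact: red_s1V.
    rewrite -half_twist_coxeter12V invgM invgK mulgA.
    exact/coset_form_half_twistV/coset_form_coxeter12.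
  have -> : sigma3^-1 = sigma1^-1 * fiberX by rewrite /fiberX mulKg.
  by rewrite mulgA; apply/coset_formM/red_s1V.
Qed.

(** * The action on pairs of integers at t = -1 *)

Section ModularAction.
Local Open Scope ring_scope.

(** Evaluation at t = -1: the ideal generated by t + 1 meets the integers
    trivially. *)
Lemma laurent_int_dvd (n : int) (q : laurent) : n%:~R = (t + 1) * q -> n = 0.
Proof.
move=> /(congr1 val); rewrite rmorphM rmorphD rmorph1 rmorph_int /=.
have /asboolP[p [k ->]] := laurent_valP q; rewrite mulrA.
move/(congr1 (fun z => z * fracX ^+ k)).
rewrite mulfVK ?expf_neq0 ?fracX_neq0 //.
rewrite -tofrac1 -tofracD -tofracM -tofracXn.
rewrite -(rmorph_int (@FracField.tofrac _)) -tofracM.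
move/eqP; rewrite tofrac_eq => /eqP/(congr1 (horner^~ (-1))).
rewrite !(hornerE, hornerXn) -(rmorph_int polyC) hornerC => /eqP.
by rewrite mulf_eq0 expf_eq0 oppr_eq0 oner_eq0 andbF orbF intz => /eqP.
Qed.

Definition act_letter (l : letter) (v : int * int) : int * int :=
  let: (x, y) := v in
  match val l.1, l.2 with
  | 1%N, false => (x + y, y)
  | 1%N, true => (x - y, y)
  | _, false => (x, y - x)
  | _, true => (x, y + x)
  end.

Definition row3 (s : seq laurent) : 'rV[laurent]_3 := \row_j nth 0 s j.

(** The rows killed by the column (1, 0, 1), which all three generators fix at
    t = -1. *)
Definition embed (v : int * int) : 'rV[laurent]_3 :=
  row3 [:: v.1%:~R; v.2%:~R; - v.1%:~R].

Definition row_congr (u v : 'rV[laurent]_3) : Prop :=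
  exists q, u = v + (t + 1) *: q.

Lemma row3M (x y z a b c d e f g h i : laurent) :
  row3 [:: x; y; z] *m mx3 [:: [:: a; b; c]; [:: d; e; f]; [:: g; h; i]] =
  row3 [:: x * a + y * d + z * g; x * b + y * e + z * h;
           x * c + y * f + z * i].
Proof.
apply/rowP=> j; rewrite !mxE !big_ord_recl big_ord0 !mxE addr0 addrA.
by case: j => [[|[|[|//]]] ?].
Qed.

Lemma row3D (x y z x' y' z' : laurent) :
  row3 [:: x; y; z] + row3 [:: x'; y'; z'] = row3 [:: x + x'; y + y'; z + z'].
Proof. by apply/rowP=> j; rewrite !mxE; case: j => [[|[|[|//]]] ?]. Qed.

Lemma row3Z (k x y z : laurent) :
  k *: row3 [:: x; y; z] = row3 [:: k * x; k * y; k * z].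
Proof. by apply/rowP=> j; rewrite !mxE; case: j => [[|[|[|//]]] ?]. Qed.

Lemma row_congrM u v M : row_congr u v -> row_congr (u *m M) (v *m M).
Proof. by case=> q ->; exists (q *m M); rewrite mulmxDl scalemxAl. Qed.

Lemma row_congr_trans v u w : row_congr u v -> row_congr v w -> row_congr u w.
Proof.
by case=> q -> [q' ->]; exists (q' + q); rewrite scalerDr addrA.
Qed.

Lemma row_congr_sym u v : row_congr u v -> row_congr v u.
Proof. by case=> q ->; exists (- q); rewrite scalerN addrK. Qed.

Lemma embed_inj u v : row_congr (embed u) (embed v) -> u = v.
Proof.
case: u v => [x y] [x' y'] [q /rowP e].
have coord (j : 'I_3) (m n : int) :
    embed (x, y) ord0 j = m%:~R -> embed (x', y') ord0 j = n%:~R -> m = n.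
  move=> mE nE; apply/eqP; rewrite -subr_eq0; apply/eqP.
  apply: (@laurent_int_dvd _ (q ord0 j)); rewrite intrB -mE -nE.
  have := e j; rewrite mxE [in RHS]mxE => ->.
  by rewrite !mxE addrAC subrr add0r.
congr pair; first by apply: (coord ord0); rewrite mxE.
by apply: (coord (@Ordinal 3 1 isT)); rewrite mxE.
Qed.

Lemma act_sigmaP i v :
  row_congr (embed v *m burau_sigma i) (embed (act_letter (i, false) v)).
Proof.
case: v => x y; case: i => [[|[|[|//]]] i3]; rewrite /burau_sigma /= row3M.
- exists (row3 [:: - x%:~R; x%:~R; 0]); rewrite row3Z row3D; congr row3.
  by rewrite /= !rmorphB /=; do ![congr (_ :: _)]; ring.
- exists (row3 [:: 0; - y%:~R; y%:~R]); rewrite row3Z row3D; congr row3.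
  by rewrite /= !rmorphD /=; do ![congr (_ :: _)]; ring.
- exists (row3 [:: 0; 0; x%:~R]); rewrite row3Z row3D; congr row3.
  by rewrite /= !rmorphB /=; do ![congr (_ :: _)]; ring.
Qed.

Lemma act_letterVK i v : act_letter (i, false) (act_letter (i, true) v) = v.
Proof.
case: v => x y.
by case: i => [[|[|[|//]]] i3]; congr pair; rewrite /= ?addrK ?subrK.
Qed.

Lemma act_letterP l v :
  row_congr (embed v *m burau_letter l) (embed (act_letter l v)).
Proof.
case: l => i [|]; last exact: act_sigmaP.
rewrite /burau_letter /=.
rewrite -[X in row_congr _ X](mulmxK (burau_sigma_unit i)).
apply/row_congrM/row_congr_sym; rewrite -{2}(act_letterVK i v).
exact: act_sigmaP.
Qed.

Definition act_word (w : word) (v : int * int) := foldr act_letter v w.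

Lemma act_wordP w v :
  row_congr (embed v *m burau_word w) (embed (act_word w v)).
Proof.
elim: w v => [|l w IHw] v /=.
  by exists 0; rewrite mulmx1 scaler0 addr0.
rewrite mulmxA; apply: row_congr_trans (act_letterP l _).
exact: row_congrM.
Qed.

Definition act (x : B4) := act_word (repr x).

Lemma actP x v : row_congr (embed v *m rho4 x) (embed (act x v)).
Proof. exact: act_wordP. Qed.

(** Since [embed] is injective modulo t + 1, the action is determined by the
    matrix; in particular the action of words descends to braids. *)
Lemma act_unique x v w : row_congr (embed v *m rho4 x) (embed w) -> act x v = w.
Proof.
by move=> vw; apply/embed_inj/row_congr_trans/vw/row_congr_sym/actP.
Qed.

Lemma act_of_word w v : act (B4_of_word w) v = act_word w v.
Proof. by apply: act_unique; rewrite rho4E; exact: act_wordP. Qed.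

(** This is a left action although the representation reverses products, because
    matrices are applied to rows from the right. *)
Lemma actM x y v : act (x * y)%g v = act x (act y v).
Proof.
apply: act_unique; rewrite rho4M mulmxA; apply: row_congr_trans (actP x _).
exact/row_congrM/actP.
Qed.

Lemma act_kernel x v : x \in burau_kernel -> act x v = v.
Proof.
move=> /eqP x1; apply: act_unique; rewrite x1 mulmx1.
by exists 0; rewrite scaler0 addr0.
Qed.

Lemma act1 v : act 1%g v = v.
Proof. exact/act_kernel/eqP/rho4_1. Qed.

Definition norm1 (v : int * int) : int := `|v.1| + `|v.2|.

Lemma act_sigma1 x y : act sigma1 (x, y) = (x, y - x).
Proof. by rewrite act_of_word. Qed.

Lemma act_sigma2 x y : act sigma2 (x, y) = (x + y, y).
Proof. by rewrite act_of_word. Qed.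

Lemma act_sigma2V x y : act sigma2^-1%g (x, y) = (x - y, y).
Proof. by rewrite -B4_of_word_inv act_of_word. Qed.

Lemma act_sigma3 x y : act sigma3 (x, y) = (x, y - x).
Proof. by rewrite act_of_word. Qed.

Lemma act_tau x y : act tau (x, y) = (y, - x).
Proof.
rewrite !actM act_sigma3 act_sigma2 act_sigma1.
by congr pair; ring.
Qed.

Lemma act_Delta x y : act Delta (x, y) = (- x, - y).
Proof.
rewrite !actM !(act_sigma1, act_sigma2, act_sigma3).
by congr pair; ring.
Qed.

(** On pairs of integers [tau] is a rotation by a quarter turn and [Delta] is
    minus the identity. *)
Lemma norm1_tauDelta x v : x \in tauDelta -> norm1 (act x v) = norm1 v.
Proof.
have gen y w : y \in pred2 tau Delta -> norm1 (act y w) = norm1 w.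
  case: w => a b; rewrite !inE => /orP[] /eqP->; rewrite ?act_tau ?act_Delta.
    by rewrite /norm1 /= normrN addrC.
  by rewrite /norm1 /= !normrN.
move=> xG; move: x xG v; apply: generated_ind => [v|x y IHx yX v|x y IHx yX v].
- by rewrite act1.
- by rewrite actM IHx gen.
- by rewrite actM IHx -(gen _ _ yX) -actM mulgV act1.
Qed.

(** The letters of [pos_prod] map the open quadrant x > 0 > y to itself, and
    each increases x - y there, by x or by -y. *)
Lemma norm1_pos_prod w x y : 0 < x -> y < 0 ->
  norm1 (x, y) + (size w)%:R <= norm1 (act (pos_prod w) (x, y)).
Proof.
suff H : forall w v, 0 < v.1 -> v.2 < 0 -> let v' := act (pos_prod w) v in
    [/\ 0 < v'.1, v'.2 < 0 & v.1 - v.2 + (size w)%:R <= v'.1 - v'.2].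
  move=> x0 y0; have [] := H w (x, y) x0 y0; rewrite /norm1 /= => x'0 y'0.
  by rewrite (gtr0_norm x0) (ltr0_norm y0) (gtr0_norm x'0) (ltr0_norm y'0).
elim=> {w x y} [|e w IHw] [x y] /= x0 y0.
  by rewrite /pos_prod big_nil act1; split; rewrite //= addr0.
have [] := IHw (x, y) x0 y0; rewrite /pos_prod big_cons actM.
move: (act _ _) => [x' y'] /=.
by case: e; rewrite ?act_sigma1 ?act_sigma2V /=; split; lia.
Qed.

(** A braid [g * pos_prod w * coxeter12 ^+ j] that acts trivially preserves
    norms, and so does [g]; hence applying [pos_prod w] to the image of a pair
    by [coxeter12 ^+ j] must restore the norm of the pair. *)
Lemma burau_kernel_sub : {subset burau_kernel <= tauDelta}.
Proof.
move=> x xK; have [g [w [j [gG j2 xE]]]] := coset_formP x.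
have normE v : norm1 v = norm1 (act (pos_prod w) (act (coxeter12 ^+ j)%g v)).
  by rewrite -[in LHS](act_kernel v xK) xE 2!actM norm1_tauDelta.
case: j j2 xE normE => [|[|[|//]]] _ xE normE.
- (* The pair (1, -1) lies in the quadrant already, so that w must be empty. *)
  have := normE (1, -1); rewrite expg0 act1 => e.
  have := @norm1_pos_prod w 1 (-1) isT isT; rewrite -e.
  case: w xE {normE e} => [xE _|? ? _]; last by rewrite gerDl lern0.
  by rewrite xE /pos_prod big_nil !mulg1.
- (* For j = 1, 2 the pair (1, 1), of norm 2, is sent into the quadrant with
       norm 3. *)
  have := normE (1, 1); rewrite expg1 actM act_sigma2 act_sigma1 => e.
  have : norm1 (2, -1) + (size w)%:R <= norm1 (1, 1).
    by rewrite e; apply: (@norm1_pos_prod w 2 (-1)).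
  by rewrite /norm1 /=; lia.
- have := normE (1, 1); rewrite expg2 !actM !(act_sigma2, act_sigma1) => e.
  have : norm1 (1, -2) + (size w)%:R <= norm1 (1, 1).
    by rewrite e; apply: (@norm1_pos_prod w 1 (-2)).
  by rewrite /norm1 /=; lia.
Qed.

End ModularAction.

(** * Alternating products in <t, D> when t^4 = D^2 is central *)

Lemma expgz_succ (G : groupType) (x : G) m : expgz x (m + 1)%R = expgz x m * x.
Proof.
case: m => [n|[|n]].
- by rewrite (_ : (Posz n + 1)%R = Posz n.+1) /= ?expgSr //; lia.
- by rewrite /= mulVg.
rewrite (_ : (Negz n.+1 + 1)%R = Negz n) /=; last by lia.
by rewrite (expgS x n.+1) invgM mulgVK.
Qed.

Lemma expgz_pred (G : groupType) (x : G) m :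
  expgz x (m - 1)%R = expgz x m * x^-1.
Proof. by rewrite -{2}[m](subrK 1%R) expgz_succ mulgK. Qed.

Lemma expgz_central (G : groupType) (z : G) m :
  (forall y, z * y = y * z) -> forall y, expgz z m * y = y * expgz z m.
Proof.
by move=> zC y; apply/commute_sym; case: m => n /=;
  [| apply: commuteV]; apply/commuteX/esym/zC.
Qed.

Section CentralProduct.
Variables (G : groupType) (t D z : G).
Hypotheses (t4 : t ^+ 4 = z) (D2 : D * D = z) (zC : forall x, z * x = x * z).

Definition syllables (s : seq nat) : G := \prod_(i <- s) (t ^+ i * D).
Definition exponents (s : seq nat) := all (mem [:: 1; 2; 3]%N) s.

Local Notation alternating := (fun x : G => exists m (e : bool) s (b : nat),
   [/\ exponents s, (b <= 3)%N &
       x = expgz z m * (D ^+ e * syllables s * t ^+ b)]).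

Let expgz_mulz m x : expgz z m * x * z = expgz z (m + 1)%R * x.
Proof. by rewrite expgz_succ -mulgA -(zC x) mulgA. Qed.

Let alternating_z x : alternating x -> alternating (x * z).
Proof. by move=> [m [e [s [b [sP bP ->]]]]]; exists (m + 1)%R, e, s, b. Qed.

Let alternating_zV x : alternating x -> alternating (x * z^-1).
Proof.
move=> [m [e [s [b [sP bP ->]]]]]; exists (m - 1)%R, e, s, b; split=> //.
by apply: (canLR (mulgK z)); rewrite expgz_mulz subrK.
Qed.

Lemma syllables_rcons s i : syllables (rcons s i) = syllables s * (t ^+ i * D).
Proof. by rewrite /syllables -cats1 big_cat big_seq1. Qed.

Lemma syllables_cons s i : syllables (i :: s) = t ^+ i * D * syllables s.
Proof. by rewrite /syllables big_cons. Qed.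

Lemma exponents_rcons s i :
  exponents (rcons s i) = (i \in [:: 1; 2; 3]%N) && exponents s.
Proof. by rewrite /exponents all_rcons. Qed.

Let alternating_t x : alternating x -> alternating (x * t).
Proof.
move=> [m [e [s [b [sP + ->]]]]]; rewrite leq_eqVlt => /orP[/eqP->|b3].
  exists (m + 1)%R, e, s, 0; split=> //.
  by rewrite mulg1 -expgz_mulz -t4 (expgSr t 3) !mulgA.
by exists m, e, s, b.+1; split; rewrite // expgSr !mulgA.
Qed.

Let alternating_D x : alternating x -> alternating (x * D).
Proof.
move=> [m [e [s [b [sP b3 ->]]]]]; case: (posnP b) => [->|b0]; last first.
  exists m, e, (rcons s b), 0; split=> //.
    by rewrite exponents_rcons sP andbT; case: b b0 b3 => [|[|[|[|]]]].
  by rewrite syllables_rcons mulg1 !mulgA.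
rewrite mulg1; case/lastP: s sP => [_|s i].
  have e' : D ^+ e * D = expgz z e * D ^+ ~~ e.
    by case: e => /=; rewrite ?expg1 ?expg0 ?mul1g ?mulg1.
  exists (m + e)%R, (~~ e), [::], 0; split=> //.
  rewrite /syllables big_nil !mulg1 -mulgA e' mulgA; congr (_ * _).
  by case: e {e'}; rewrite ?expgz_succ ?expg1 // addr0 mulg1.
rewrite exponents_rcons => /andP[iP sP].
rewrite syllables_rcons -!mulgA D2 !mulgA -2!(mulgA (expgz z m)).
apply: alternating_z; exists m, e, s, i; split=> //.
by move: iP; rewrite !inE; case: i => [|[|[|[|]]]].
Qed.

Lemma alternating_form x : x \in generated (pred2 t D) -> alternating x.
Proof.
move: x; apply: generated_ind => [|x y xn|x y xn].
- exists 0%R, false, [::], 0; split=> //.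
  by rewrite /syllables big_nil !mulg1.
- rewrite !inE => /orP[] /eqP->; first exact: alternating_t.
  exact: alternating_D.
rewrite !inE => /orP[] /eqP->.
  rewrite (_ : t^-1 = t * t * t * z^-1); last first.
    by rewrite -t4 !expgSr expg0 mul1g !invgM -!mulgA !mulVKg.
  by rewrite !mulgA; apply/alternating_zV; do 3!apply: alternating_t.
rewrite (_ : D^-1 = D * z^-1); last by rewrite -D2 invgM mulVKg.
by rewrite mulgA; apply/alternating_zV/alternating_D.
Qed.

(** A leading [D] is moved to the end by conjugation, where it merges with the
    last syllable. If the product then starts with a power of [t] and ends with
    [D], conjugation by [t] or by its inverse splits the first power of [t] in
    two nontrivial pieces, one of which goes to the end. *)
Lemma conj_alternating_form x : x \in generated (pred2 t D) ->
  exists g m, x ^ g = expgz z m \/ x ^ g = expgz z m * D \/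
    exists s b, [/\ exponents s, b \in [:: 1; 2; 3]%N &
                    x ^ g = expgz z m * (syllables s * t ^+ b)].
Proof.
move=> /alternating_form[m [e [s [b [sP bP ->]]]]].
have bE : (0 < b)%N -> b \in [:: 1; 2; 3]%N.
  by case: b bP => [|[|[|[|]]]].
pose zK m := expgz_central m zC.
have zJ k y g : (expgz z k * y) ^ g = expgz z k * y ^ g.
  by rewrite conjMg; congr (_ * _); rewrite conjgE zK mulKg.
have shift k s' : exponents s' -> exists g m',
  (expgz z k * syllables s') ^ g = expgz z m' \/
  exists s b, [/\ exponents s, b \in [:: 1; 2; 3]%N &
     (expgz z k * syllables s') ^ g = expgz z m' * (syllables s * t ^+ b)].
  case: s' => [_|i s' /= /andP[iP s'P]].
    by exists 1, k; left; rewrite /syllables big_nil mulg1 conjg1.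
  (* The exponent 3 is split as 2 + 1; the exponents i = 1, 2 become i + 1, and
     the inverse of t at the end is t^3 up to z. *)
  have [i3|i3] := boolP (i == 3)%N.
    exists t, k; right; exists (2 :: s')%N, 1%N; split=> //.
    rewrite zJ !syllables_cons (eqP i3) conjgE (expgS t 2) expg1.
    by rewrite -!mulgA mulKg.
  exists t^-1, (k - 1)%R; right; exists (i.+1 :: s')%N, 3%N; split=> //.
    rewrite /= s'P andbT; move: iP i3.
    by rewrite !inE; case: i => [|[|[|[|]]]].
  rewrite zJ !syllables_cons conjgE invgK expgz_pred -[in RHS]mulgA.
  congr (_ * _).
  rewrite (_ : t^-1 = t ^+ 3 * z^-1); last first.
    by rewrite -t4 (expgS t 3) invgM mulVKg.
  have zVC y : z^-1 * y = y * z^-1.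
    by apply: (mulgI z); rewrite mulVKg mulgA zC mulgK.
  by rewrite zVC (expgS t i) !mulgA.
case: e; last first.
  rewrite mul1g; case: (posnP b) => [->|b0].
    rewrite mulg1; have [g [m' [e|h]]] := shift m s sP.
      by exists g, m'; left.
    by exists g, m'; do 2!right.
  by exists 1, m; do 2!right; exists s, b; rewrite conjg1 bE.
have move_D y : (expgz z m * (D ^+ true * y)) ^ D = expgz z m * (y * D).
  by rewrite zJ conjgE -!mulgA mulKg.
case: (posnP b) => [->|b0].
  rewrite mulg1; case/lastP: s sP => [_|s i].
    exists 1, m; right; left.
    by rewrite conjg1 /syllables big_nil mulg1 expg1.
  rewrite exponents_rcons => /andP[iP sP].
  exists D, (m + 1)%R; do 2!right; exists s, i; split=> //.
  by rewrite move_D syllables_rcons -!mulgA D2 -expgz_mulz !mulgA.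
have s'P : exponents (rcons s b) by rewrite exponents_rcons bE.
have [g [m' h]] := shift m _ s'P.
exists (D * g), m'; rewrite conjgM -mulgA move_D -mulgA -syllables_rcons.
by case: h => h; [left | do 2!right].
Qed.

(** The inverses of [D] and of the square of [t] are these elements themselves
    up to [z], which accounts for the shift of [m] by 2. *)
Lemma conj_sandwich m y : (expgz z m * y) ^ (t ^+ 2 * D)^-1 =
  expgz z (m - 1 - 1)%R * (t ^+ 2 * D * (y * D) * t ^+ 2).
Proof.
have TT : t ^+ 2 * t ^+ 2 = z by rewrite -(expgnDr t 2 2).
rewrite conjgE invgK mulgA; apply: (canLR (mulgK _)).
move: (t ^+ 2) TT => T TT.
have -> : T * D * (expgz z m * y) = expgz z m * (T * D * y).
  by rewrite mulgA -(expgz_central m zC) -[LHS]mulgA.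
have -> : expgz z m = expgz z (m - 1 - 1)%R * z * z.
  by rewrite -!expgz_succ !subrK.
rewrite -!mulgA; congr (_ * _); rewrite (mulgA T T) TT (zC D) (mulgA D D) D2.
by rewrite zC -mulgA zC -!mulgA.
Qed.

End CentralProduct.

(** * Powers of theta and the shape of kernel elements *)

Lemma theta_central (x : B4) : theta * x = x * theta.
Proof.
have tau2a := coxeter2_mul1 sigma_braid12 sigma_braid23 sigma_comm13 tauE.
have tau2c := coxeter2_mul3 sigma_braid12 sigma_braid23 sigma_comm13 tauE.
have thetaE2 : theta = tau ^+ 2 * tau ^+ 2 by rewrite -(expgnDr tau 2 2).
have thetaT : commute theta tau by apply/commute_sym/commuteX.
have theta1 : commute theta sigma1.
  rewrite /commute thetaE2 -(mulgA (tau ^+ 2)) tau2a (mulgA (tau ^+ 2)) tau2c.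
  by rewrite -(mulgA sigma1).
have theta3 : commute theta sigma3.
  rewrite /commute thetaE2 -(mulgA (tau ^+ 2)) tau2c (mulgA (tau ^+ 2)) tau2a.
  by rewrite -(mulgA sigma3).
have theta2 : commute theta sigma2.
  rewrite -(mulgK tau sigma2).
  rewrite -(coxeter_mul1 sigma_braid12 sigma_comm13 tauE).
  by apply/commuteM/commuteV => //; apply: commuteM.
elim/B4_ind: x => [|y s yC|y s yC]; first by rewrite mulg1 mul1g.
- by rewrite !inE => /or3P[] /eqP->; apply: commuteM.
- by rewrite !inE => /or3P[] /eqP->; apply/commuteM/commuteV.
Qed.

(** The matrix of [tau] is t times an integral matrix of order 4. *)
Lemma rho4_theta : rho4 theta = ((t ^+ 4)%:M)%R.
Proof.
have rho4_tau :
    rho4 tau = mx3 [:: [:: -t; t; 0]; [:: -t; 0; t]; [:: -t; 0; 0]]%R.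
  rewrite !rho4M rho4_sigma1 rho4_sigma2 rho4_sigma3 !mx3M.
  by congr mx3; do ![congr (_ :: _)]; ring.
have rho4_tau2 : rho4 (tau ^+ 2) =
    (t ^+ 2 *: mx3 [:: [:: 0; -1; 1]; [:: 0; -1; 0]; [:: 1; -1; 0]])%R.
  rewrite expg2 rho4M rho4_tau mx3M; apply/matrixP=> i j; rewrite !mxE.
  by case: i => [[|[|[|//]]] ?]; case: j => [[|[|[|//]]] ?] /=; ring.
rewrite /theta (expgnDr tau 2 2) rho4M rho4_tau2 -scalemxAl -scalemxAr mx3M.
rewrite scalerA -scalemx1 -mx3_1 -exprD; congr (_ *: _)%R.
by congr mx3; do ![congr (_ :: _)]; ring.
Qed.

Lemma burau_kernelJ x y : x \in burau_kernel -> x ^ y \in burau_kernel.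
Proof.
move=> /eqP x1; apply/eqP.
by rewrite conjgE !rho4M x1 mulmx1 -rho4M mulVg rho4_1.
Qed.

Lemma burau_kernelV x : x \in burau_kernel -> x^-1 \in burau_kernel.
Proof.
move=> /eqP x1; apply/eqP.
by rewrite -[LHS]mul1mx -x1 -rho4M mulVg rho4_1.
Qed.

Lemma t_exp_eq1 n : (t ^+ n = 1)%R -> n = 0.
Proof.
move=> /(congr1 val); rewrite rmorphXn rmorph1 /= -tofracXn -tofrac1.
move=> /eqP; rewrite tofrac_eq => /eqP/(congr1 (fun p : {poly int} => size p)).
by rewrite size_polyXn size_poly1 => -[].
Qed.

Lemma theta_expgz_kernel m : expgz theta m \in burau_kernel -> m = 0%R.
Proof.
have pow n : theta ^+ n \in burau_kernel -> n = 0.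
  have -> : theta ^+ n \in burau_kernel = (rho4 (theta ^+ n) == (1%:M)%R) by [].
  have -> : rho4 (theta ^+ n) = (((t ^+ 4) ^+ n)%:M)%R.
    elim: n => [|n IHn]; first by rewrite expg0 rho4_1.
    by rewrite expgSr rho4M IHn rho4_theta (exprS (t ^+ 4)%R) scalar_mxM.
  move=> /eqP/matrixP/(_ ord0 ord0); rewrite !mxE /= -exprM => /t_exp_eq1.
  by case: n.
case: m => n /=; first by move/pow->.
by move/burau_kernelV; rewrite invgK => /pow.
Qed.

Lemma act_theta_expgz m v : act (expgz theta m) v = v.
Proof.
have act_n n : act (theta ^+ n) v = v.
  elim: n => [|n IHn]; first by rewrite expg0 act1.
  rewrite expgSr actM -{2}IHn; congr (act _ _); case: v {IHn} => x y.
  by rewrite /theta !expgS expg0 mulg1 3!(actM tau) !act_tau; congr pair; ring.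
case: m => n /=; first exact: act_n.
by rewrite -{1}(act_n n.+1) -actM mulVg act1.
Qed.

Lemma theta_Delta_kernel m : expgz theta m * Delta \notin burau_kernel.
Proof.
apply/negP=> /(@act_kernel _ (1, 0)%R).
by rewrite actM act_theta_expgz act_Delta.
Qed.

Theorem theorem2p3 :
  {subset burau_kernel <= generated (pred2 tau Delta)} /\
  ((exists2 x : B4, x \in burau_kernel & x <> 1%g) ->
   exists2 w : B4, w \in burau_kernel & w <> 1%g /\
     exists (m : int) (k : nat) (i : 'I_k -> nat),
       [/\ (1 <= k)%N,
           forall j : 'I_k, i j \in [:: 1; 2; 3]%N
         & w = (expgz theta m * (tau ^+ 2 * Delta
                * (\prod_(j < k) (tau ^+ i j * Delta)) * tau ^+ 2))%g]).
Proof.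
split; first exact: burau_kernel_sub.
move=> [x xK x1].
have D2 : Delta * Delta = theta by rewrite thetaE expg2.
have [g [m xg]] := conj_alternating_form (erefl theta) D2 theta_central
  (burau_kernel_sub xK).
have {xK} := burau_kernelJ g xK.
have {x1} : x ^ g <> 1 by move/eqP; rewrite conjg_eq1 => /eqP.
move: (x ^ g) xg => y [->|[->|[s [b [sP bP ->]]]]].
- by move=> + /theta_expgz_kernel m0; rewrite m0.
- by move=> _ H; case/negP: (theta_Delta_kernel m).
set w := _ * _ => w1 wK; pose h := (tau ^+ 2 * Delta)^-1.
exists (w ^ h); first exact: burau_kernelJ.
split; first by move/eqP; rewrite conjg_eq1 => /eqP.
have s'P : exponents (rcons s b) by rewrite exponents_rcons bP.
(* The last power of tau and the Delta contributed by the conjugation form one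
   more syllable. *)
exists (m - 1 - 1)%R, (size (rcons s b)), (fun j => nth 0 (rcons s b) j).
split; first by rewrite size_rcons.
  by move=> j; apply: (allP s'P); apply: mem_nth.
rewrite -(big_mkord xpredT (fun j => tau ^+ nth 0 (rcons s b) j * Delta)).
rewrite -(big_nth 0 xpredT (fun i => tau ^+ i * Delta)).
rewrite -[\big[_/_]_(_ <- _) _]/(syllables tau Delta (rcons s b)).
rewrite syllables_rcons [X in _ * X * _]mulgA.
exact (conj_sandwich (erefl theta) D2 theta_central m _).
Qed.
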